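(* Let $\mathcal{L} = (G, a_0, I, \theta)$ be a ladget with $G=(V,E)$ and $I=(i_1,\dots,i_n)$. Then: (1) no two inputs are adjacent; (2) $a_0$ is not adjacent to any input; (3) no internal vertex (a vertex of $V \setminus (I \cup \{a_0,\theta\})$) is adjacent to three distinct vertices of $I \cup \{a_0\}$.
   Context: A ladget is a tuple $\mathcal{L}=(G,a_0,I,\theta)$ where $G=(V,E)$ is a finite simple graph, $a_0\in V$ is the anchor vertex, $I=(i_1,\dots,i_n)$ ($n\ge 1$) is an ordered tuple of distinct input vertices, and $\theta\in V$ is the output vertex, with $a_0$, the inputs and $\theta$ pairwise distinct. A valid 3-coloring is a proper coloring $c:V\to\{0,1,2\}$ (adjacent vertices get distinct colors) with $c(a_0)=0$. A vertex has Boolean value $0$ if its color is $0$ and Boolean value $1$ if its color is in $\{1,2\}$. $\mathcal{L}$ is required to implement a Boolean function $\varphi:\{0,1\}^n\to\{0,1\}$ that depends on every input, meaning: (Universality) every assignment of colors from $\{0,1,2\}$ to the input vertices extends to a valid 3-coloring; (Consistency) in every valid 3-coloring, the Boolean value of $\theta$ equals $\varphi$ applied to the Boolean values of $i_1,\dots,i_n$. *)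

(* Defs.v *)
From mathcomp Require Import all_boot.

Set Implicit Arguments.
Unset Strict Implicit.
Unset Printing Implicit Defensive.

Record sgraph := SGraph {
  vertex :> finType;
  adj : rel vertex;
  adj_sym : symmetric adj;
  adj_irrefl : irreflexive adj
}.

(* The raw data (G, a_0, I, theta); the conditions are in [is_ladget]. *)
Record ladget_data (n : nat) := LadgetData {
  graph : sgraph;
  anchor : graph;
  inputs : n.-tuple graph;
  output : graph
}.

Definition color := 'I_3.

Section Ladget.

Variables (n : nat) (L : ladget_data n).

Definition valid_coloring (c : graph L -> color) : Prop :=
  (forall u v : graph L, adj u v -> c u <> c v) /\ c (anchor L) = ord0.

Definition bool_value (x : color) : bool := x != ord0.

Definition depends_on (phi : n.-tuple bool -> bool) (k : 'I_n) : Prop :=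
  exists x y : n.-tuple bool,
    (forall j : 'I_n, j != k -> tnth x j = tnth y j) /\ phi x <> phi y.

Definition universality : Prop :=
  forall g : 'I_n -> color, exists c : graph L -> color,
    valid_coloring c /\ forall k : 'I_n, c (tnth (inputs L) k) = g k.

Definition consistency (phi : n.-tuple bool -> bool) : Prop :=
  forall c : graph L -> color, valid_coloring c ->
    bool_value (c (output L)) =
      phi (map_tuple (fun i => bool_value (c i)) (inputs L)).

Definition implements (phi : n.-tuple bool -> bool) : Prop :=
  universality /\ consistency phi.

Definition is_ladget : Prop :=
  [/\ 0 < n,
      uniq (anchor L :: output L :: inputs L)
    & exists phi : n.-tuple bool -> bool,
        (forall k : 'I_n, depends_on phi k) /\ implements phi].

Definition internal (v : graph L) : bool :=
  v \notin anchor L :: output L :: inputs L.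

End Ladget.

(* Main.v *)
(** Only universality is used: any colors prescribed on the inputs and the
    anchor, with the anchor colored 0, extend to a valid coloring.  Coloring all
    of them 0 rules out edges among them.  If a vertex had three distinct
    neighbours among them, prescribing three different colors there would leave
    no color for that vertex; a permutation of the colors brings the color of
    the anchor back to 0. *)
Require Import Defs.
From mathcomp Require Import all_boot.
From mathcomp Require Import perm.

Lemma universality_extend {n : nat} {L : ladget_data n}
    (h : graph L -> color) :
  universality L -> h (anchor L) = ord0 ->
  exists2 c, valid_coloring c & {in anchor L :: inputs L, c =1 h}.
Proof.
move=> univ h0; have [c [vc cg]] := univ (fun k => h (tnth (inputs L) k)).
exists c => // u; rewrite inE => /predU1P[-> | /tnthP[k ->]]; last exact: cg.
by case: vc => _ ->.
Qed.

Lemma anchor_inputs_nonadjacent {n : nat} {L : ladget_data n} (x y : graph L) :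
  universality L -> x \in anchor L :: inputs L -> y \in anchor L :: inputs L ->
  ~~ adj x y.
Proof.
move=> univ xI yI.
have [c [proper _] ch] := universality_extend (fun=> ord0) univ erefl.
by apply/negP => /proper; rewrite !ch.
Qed.

Lemma no_three_anchor_input_neighbours {n : nat} {L : ladget_data n}
    {v x y z : graph L} :
  universality L -> uniq [:: x; y; z] ->
  {subset [:: x; y; z] <= anchor L :: inputs L} ->
  adj v x -> adj v y -> ~~ adj v z.
Proof.
move=> univ uxyz sI vx vy; apply/negP => vz.
(* [x], [y], [z] get colors 0, 1, 2. Any other vertex has index 3, which [inord] sends to 0; so an
   anchor outside the triple already has color 0 and [s] is the identity. *)
pose f u : color := inord (index u [:: x; y; z]).
pose s := tperm (f (anchor L)) (ord0 : color).
have [|c [proper _] ch] := universality_extend (fun u => s (f u)) univ.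
  exact: tpermL.
(* [w] is the neighbour whose prescribed color clashes with [v]: [f w = s (c v)], and [s] is an
   involution, so [s (f w) = c v]. *)
pose w := nth x [:: x; y; z] (s (c v)).
have wI : w \in [:: x; y; z] by exact/mem_nth/ltn_ord.
have cw : c w = c v.
  by rewrite ch ?sI // /f index_uniq ?ltn_ord // inord_val tpermK.
have /proper : adj v w by move: wI; rewrite !inE => /or3P[] /eqP->.
by rewrite cw.
Qed.

Theorem mainTheorem5 (n : nat) (L : ladget_data n) (hL : is_ladget L) :
  [/\ (* no two inputs are adjacent *)
      forall x y : graph L,
        x \in inputs L -> y \in inputs L -> x != y -> ~~ adj x y,
      (* the anchor is not adjacent to any input *)
      forall x : graph L, x \in inputs L -> ~~ adj (anchor L) x
    & (* no internal vertex has three distinct neighbours in I and a_0 *)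
      forall v : graph L, internal v ->
        ~ exists x y z : graph L,
            [/\ uniq [:: x; y; z],
                {subset [:: x; y; z] <= anchor L :: inputs L}
              & [/\ adj v x, adj v y & adj v z]]].
Proof.
have [_ _ [phi [_ [univ _]]]] := hL.
split=> [x y xI yI _ | x xI | v _ [x [y [z [uxyz sI [vx vy vz]]]]]].
- by apply: anchor_inputs_nonadjacent; rewrite // inE ?xI ?yI orbT.
- by apply: anchor_inputs_nonadjacent; rewrite // inE ?eqxx ?xI ?orbT.
- by have /negP := no_three_anchor_input_neighbours univ uxyz sI vx vy; apply.
Qed.
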